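(* Let $\mathcal{X}\subset\mathbb{R}^d$, let $f:\mathcal{X}\to\mathcal{X}$ be measurable, and let $\nu$ be an $f$-invariant ergodic SRB (Sinai–Ruelle–Bowen) probability measure supported on $\mathcal{X}$. Let $\tilde{x}\in\mathcal{X}$ be a point at which the local dimension $d_{\nu}=\lim_{r\to 0}\frac{\log\nu(B(\tilde x,r))}{\log r}$ exists, and suppose condition (A2) holds at $\tilde{x}$. Let $\phi(x)=-\log(\operatorname{dist}(x,\tilde{x}))$, $X_i=\phi\circ f^{i-1}$ and $M_n=\max(X_1,\dots,X_n)$. \begin{enumerate} \item If (A1) holds with $\Theta(n)=O(\theta_0^{n})$ for some $\theta_0<1$, then $\lim_{n\to\infty}\frac{M_n(x)}{\log n}=\frac{1}{d_{\nu}}$ for $\nu$-a.e. $x$. \item If (A1) holds with $\Theta(n)=O(n^{-\zeta})$ for some $\zeta>0$, then there exists $\beta\in(0,1)$ such that for $\nu$-a.e. $x$: \[\frac{\beta}{d_{\nu}}\leq\liminf_{n\to\infty}\frac{M_n(x)}{\log n}\quad\text{and}\quad\limsup_{n\to\infty}\frac{M_n(x)}{\log n}\leq\frac{1}{d_{\nu}}.\] \end{enumerate}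
   Context: $B(x,r)$ denotes the ball of radius $r$ centred at $x$. Condition (A1) (decay of correlations for Lipschitz observables): there is a monotonically decreasing sequence $\Theta(j)\to0$ such that for all Lipschitz $\varphi_1,\varphi_2$ and all $j$, $\left|\int\varphi_1\cdot\varphi_2\circ f^j\,d\nu-\int\varphi_1\,d\nu\int\varphi_2\,d\nu\right|\le\Theta(j)\|\varphi_1\|_{\mathrm{Lip}}\|\varphi_2\|_{\mathrm{Lip}}$, where $\|\cdot\|_{\mathrm{Lip}}$ is the Lipschitz norm. ''(A1) holds with $\Theta(n)=O(\cdot)$'' means (A1) holds for a rate function $\Theta$ with that bound. Condition (A2) at $\tilde x$ (regularity of $\nu$ on shrinking annuli): there exist $\delta>0$, $r_0>0$ and $C>0$ (depending on $\tilde x$) such that for all $0<\epsilon<r<r_0$, $|\nu(B(\tilde{x},r+\epsilon))-\nu(B(\tilde{x},r))|\leq C\epsilon^{\delta}$. *)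

(* Defs.v *)
From HB Require Import structures.
From mathcomp Require Import all_boot all_order all_algebra.
From mathcomp Require Import all_classical all_reals all_analysis.
Set Implicit Arguments. Unset Strict Implicit. Unset Printing Implicit Defensive.
Import Order.TTheory GRing.Theory Num.Theory.
Import numFieldNormedType.Exports.
Local Open Scope classical_set_scope.
Local Open Scope ring_scope.

Definition Rd (R : realType) (d : nat) : Type :=
  g_sigma_algebraType (@open 'rV[R]_d).

Definition edist {R : realType} {d : nat} (x y : 'rV[R]_d) : R :=
  Num.sqrt (\sum_(i < d) (x ord0 i - y ord0 i) ^+ 2).

Definition eball {R : realType} {d : nat} (x : Rd R d) (r : R) : set (Rd R d) :=
  [set y | edist x y < r].

Definition phi {R : realType} {d : nat} (xt : Rd R d) (x : Rd R d) : \bar R :=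
  if edist x xt == 0 then +oo%E else (- ln (edist x xt))%:E.

Definition Mn {R : realType} {d : nat} (f : Rd R d -> Rd R d) (xt : Rd R d)
  (n : nat) (x : Rd R d) : \bar R :=
  \big[maxe/-oo%E]_(i < n) phi xt (iter i f x).

Definition Mratio {R : realType} {d : nat} (f : Rd R d -> Rd R d) (xt : Rd R d)
  (x : Rd R d) (n : nat) : \bar R :=
  (Mn f xt n x * ((ln n%:R)^-1)%:E)%E.

Definition is_lip {R : realType} {d : nat} (Xs : set (Rd R d)) (g : Rd R d -> R) :=
  exists A K : R, (forall x, Xs x -> `|g x| <= A) /\
    (forall x y, Xs x -> Xs y -> `|g x - g y| <= K * edist x y).

Definition lip_norm {R : realType} {d : nat} (Xs : set (Rd R d)) (g : Rd R d -> R) : R :=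
  sup [set `|g x| | x in Xs] +
  sup [set t | exists x y, [/\ Xs x, Xs y, edist x y != 0 &
                          t = `|g x - g y| / edist x y]].

Definition cond_A1 {R : realType} {d : nat} (nu : probability (Rd R d) R)
  (Xs : set (Rd R d)) (f : Rd R d -> Rd R d) (Theta : nat -> R) :=
  [/\ (forall m n, (m <= n)%N -> Theta n <= Theta m),
      Theta @ \oo --> 0 &
      forall (g1 g2 : Rd R d -> R) (j : nat), is_lip Xs g1 -> is_lip Xs g2 ->
        (`| (\int[nu]_(x in Xs) (g1 x * g2 (iter j f x))%:E)
            - (\int[nu]_(x in Xs) (g1 x)%:E) * (\int[nu]_(x in Xs) (g2 x)%:E) |
         <= (Theta j * lip_norm Xs g1 * lip_norm Xs g2)%:E)%E].

Definition cond_A2 {R : realType} {d : nat} (nu : probability (Rd R d) R)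
  (xt : Rd R d) :=
  exists delta r0 C : R, [/\ 0 < delta, 0 < r0, 0 < C &
    forall eps r, 0 < eps -> eps < r -> r < r0 ->
      `| fine (nu (eball xt (r + eps))) - fine (nu (eball xt r)) | <= C * eps `^ delta].

Definition local_dim {R : realType} {d : nat} (nu : probability (Rd R d) R)
  (xt : Rd R d) (dnu : R) :=
  (forall r, 0 < r -> (0 < nu (eball xt r))%E) /\
  (fun r => ln (fine (nu (eball xt r))) / ln r) @ 0^'+ --> dnu.

Definition f_invariant {R : realType} {d : nat} (nu : probability (Rd R d) R)
  (Xs : set (Rd R d)) (f : Rd R d -> Rd R d) :=
  forall A, measurable A -> nu (Xs `&` f @^-1` A) = nu A.

Definition f_ergodic {R : realType} {d : nat} (nu : probability (Rd R d) R)
  (Xs : set (Rd R d)) (f : Rd R d -> Rd R d) :=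
  forall A, measurable A -> Xs `&` f @^-1` A = Xs `&` A ->
    nu A = 0%E \/ nu A = 1%E.

Definition inv_dim {R : realType} (dnu : R) : \bar R :=
  if dnu == 0 then +oo%E else (dnu^-1)%:E.

(* Main.v *)
(* Only the lower bound uses decay of correlations.  Upper bound: by invariance
   an orbit segment of length 2^(k+1) meets B(xt, 2^(-uk)) with probability at
   most 2^(k+1) nu(B(xt, 2^(-uk))), which is summable as soon as u > 1/dnu, so
   Borel-Cantelli along this dyadic scale bounds the limsup.
   Lower bound: let g be a Lipschitz bump supported in B(xt, r) and sample the
   orbit only at the times p, 2p, .., qp.  Decorrelation over the gap p and the
   second moment method bound the probability of missing B(xt, r) up to time pq
   by 2/(q b) + 16 Theta(p)/(r b)^2, with b = nu(B(xt, r/2)).  With p = 2^k,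
   q = 2^(bk) and r = 2^(-s(b+1)k) both terms are geometric: for any s < 1/dnu
   (and large b) if Theta decays faster than every power, and for some s > 0 if
   Theta decays polynomially.
   If dnu = 0, (A2) forces an atom at xt: telescoping
   nu(B(xt, (3/2)r)) <= nu(B(xt, r)) + C (r/2)^delta would otherwise give
   nu(B(xt, r)) = O(r^delta).  By ergodicity almost every orbit hits this atom,
   so M_n = +oo eventually. *)
Require Import Defs.
From HB Require Import structures.
From mathcomp Require Import all_boot all_order all_algebra.
From mathcomp Require Import all_classical all_reals all_analysis.
From mathcomp Require Import measurable_realfun ring lra.
Import Order.TTheory GRing.Theory Num.Theory.
Import numFieldNormedType.Exports.
Local Open Scope classical_set_scope.
Local Open Scope ring_scope.

(* the unqualified name is shadowed by the [edist] of MathComp-Analysis *)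
Local Notation edist := Defs.edist.

(** * The Euclidean distance *)

Lemma edist_ge0 (R : realType) (d : nat) (x y : 'rV[R]_d) : 0 <= edist x y.
Proof. exact: sqrtr_ge0. Qed.

Lemma edistC (R : realType) (d : nat) (x y : 'rV[R]_d) : edist x y = edist y x.
Proof. by rewrite /edist; congr Num.sqrt; apply: eq_bigr => i _; ring. Qed.

Lemma edist_refl (R : realType) (d : nat) (x : 'rV[R]_d) : edist x x = 0.
Proof. by rewrite /edist big1 ?sqrtr0// => i _; rewrite subrr expr0n. Qed.

Lemma edist0_eq (R : realType) (d : nat) (x y : 'rV[R]_d) :
  edist x y = 0 -> x = y.
Proof.
move=> /eqP; rewrite sqrtr_eq0 => h.
have /eqP : \sum_(i < d) (x ord0 i - y ord0 i) ^+ 2 = 0.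
  by apply/eqP; rewrite eq_le h sumr_ge0// => i _; exact: sqr_ge0.
rewrite psumr_eq0 => [/allP h0|i _]; last exact: sqr_ge0.
apply/rowP => i; have := h0 i (mem_index_enum _).
by rewrite /= sqrf_eq0 subr_eq0 => /eqP.
Qed.

(** Lagrange's identity: the sum over i, j of (a_i b_j - a_j b_i)^2 is twice the difference of the
    two sides. *)
Lemma sum_cauchy_schwarz (R : realType) (I : finType) (a b : I -> R) :
  (\sum_i a i * b i) ^+ 2 <= (\sum_i a i ^+ 2) * (\sum_i b i ^+ 2).
Proof.
have E i j : (a i * b j - a j * b i) ^+ 2 = a i ^+ 2 * b j ^+ 2 +
    b i ^+ 2 * a j ^+ 2 - 2 * ((a i * b i) * (a j * b j)) by ring.
have : 0 <= \sum_i \sum_j (a i * b j - a j * b i) ^+ 2.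
  by apply: sumr_ge0 => i _; apply: sumr_ge0 => j _; exact: sqr_ge0.
under eq_bigr => i _ do under eq_bigr => j _ do rewrite E.
under eq_bigr => i _ do rewrite sumrB big_split/= -!mulr_sumr.
rewrite sumrB big_split/= -!mulr_suml -mulr_sumr -mulr_suml.
set A := \sum_i a i ^+ 2; set B := \sum_i b i ^+ 2; set C := \sum_i _ * _.
rewrite (_ : _ - _ = 2 * (A * B - C ^+ 2)); last by ring.
by rewrite pmulr_rge0 // subr_ge0.
Qed.

(** After squaring, only the cross term remains to be bounded, and this is Cauchy-Schwarz. *)
Lemma edist_triangle (R : realType) (d : nat) (x y z : 'rV[R]_d) :
  edist x z <= edist x y + edist y z.
Proof.
rewrite -[leRHS]ger0_norm ?addr_ge0 ?edist_ge0// -sqrtr_sqr ler_wsqrtr//.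
rewrite sqrrD !sqr_sqrtr ?sumr_ge0//; try by move=> i _; exact: sqr_ge0.
have E i : x ord0 i - z ord0 i =
  (x ord0 i - y ord0 i) + (y ord0 i - z ord0 i) by ring.
under eq_bigr => i _ do rewrite E sqrrD.
rewrite !big_split/= lerD2r lerD2l -mulr2n lerMn2r/=.
have := sum_cauchy_schwarz _ _ (fun i => x ord0 i - y ord0 i)
  (fun i => y ord0 i - z ord0 i).
move=> h; apply: le_trans (ler_norm _) _.
rewrite -sqrtr_sqr -sqrtrM ?sumr_ge0//; last by move=> i _; exact: sqr_ge0.
by rewrite ler_wsqrtr.
Qed.

Lemma edist_continuous (R : realType) (d : nat) (x : 'rV[R]_d) :
  continuous (fun y : 'rV[R]_d => edist y x).
Proof.
move=> y; rewrite /edist.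
apply: (@continuous_comp _ _ _
  (fun y : 'rV[R]_d => \sum_(i < d) (y ord0 i - x ord0 i) ^+ 2) Num.sqrt);
  last exact: sqrt_continuous.
apply: (@continuous_big R^o _ +%R 0 xpredT _ 'rV[R]_d) => [|i _ {}y].
  exact: add_continuous.
apply: (@continuous_comp _ _ _ (fun y : 'rV[R]_d => y ord0 i - x ord0 i)
  (fun t : R => t ^+ 2)); last exact: exprn_continuous.
apply: (@continuousB _ _ _ (fun y : 'rV[R]_d => y ord0 i : R^o) (cst (x ord0 i))).
  exact: (@coord_continuous R 1 d ord0 i y).
exact: cst_continuous.
Qed.

Lemma measurable_eball (R : realType) (d : nat) (x : Rd R d) (r : R) :
  measurable (eball x r).
Proof.
apply: sub_sigma_algebra => /=.
have -> : eball x r = (fun y : 'rV[R]_d => edist y x) @^-1` [set t | t < r].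
  by apply/seteqP; split=> y /=; rewrite edistC.
apply: open_comp; last exact: open_lt.
by move=> y _; exact: edist_continuous.
Qed.

Lemma measurable_point (R : realType) (d : nat) (x : Rd R d) :
  measurable [set x].
Proof.
rewrite (_ : [set x] = \bigcap_n eball x n.+1%:R^-1).
  by apply: bigcap_measurable => // n _; exact: measurable_eball.
apply/seteqP; split=> [y -> n _ /=|y h].
  by rewrite /eball /= edist_refl invr_gt0.
apply/esym/edist0_eq/eqP; rewrite eq_le edist_ge0 andbT.
apply/ler_addgt0Pr => e e0; rewrite add0r.
have /ltW h1 := h (Num.truncn e^-1) I.
apply: le_trans h1 _; rewrite -[leRHS]invrK lef_pV2 ?posrE ?invr_gt0//.
by apply: ltW; exact: truncnS_gt.
Qed.

Lemma measurable_edist (R : realType) (d : nat) (x : Rd R d) :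
  measurable_fun setT (fun y : Rd R d => edist y x).
Proof.
apply: (measurability _ (measurable_realfun.RGenInftyO.measurableE R)).
move=> _ [_ [r ->] <-].
rewrite setTI (_ : _ @^-1` _ = eball x r); first exact: measurable_eball.
by apply/seteqP; split=> y /=; rewrite in_itv/= edistC.
Qed.

(** * Second moments and invariance *)

(** Chebyshev's inequality for S, the sum of the [Y i], whose mean is N = q m. On [A] the deviation
    is exactly N. In the second moment of S the diagonal contributes at most N, because Y^2 <= Y,
    and the rest at most q^2 (m^2 + c); hence the variance is at most N + q^2 c. *)
Lemma second_moment_bound {disp} {T : measurableType disp} {R : realType}
  (P : {measure set T -> \bar R}) (D : set T) (q : nat) (Y : 'I_q -> T -> R) (m c : R)
  (A : set T) :
  measurable D -> P D = 1%E -> 0 <= m -> 0 <= c ->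
  (forall i, measurable_fun D (Y i)) ->
  (forall i x, D x -> 0 <= Y i x <= 1) ->
  (forall i, (\int[P]_(x in D) (Y i x)%:E)%E = m%:E) ->
  (forall i j, i != j ->
    (\int[P]_(x in D) (Y i x * Y j x)%:E <= (m ^+ 2 + c)%:E)%E) ->
  measurable A -> A `<=` D -> (forall i x, A x -> Y i x = 0) ->
  (q%:R * m) ^+ 2 * fine (P A) <= q%:R * m + q%:R ^+ 2 * c.
Proof.
move=> mD PD m0 c0 mY Y01 EY EYY mA AD YA.
set N := q%:R * m.
have N0 : 0 <= N by rewrite mulr_ge0.
have Y0 i x : D x -> 0 <= Y i x by move=> /(Y01 i)/andP[].
(* (sum Y - N)^2 >= N^2 \1_A, arranged so that only nonnegative functions are
   integrated *)
have key x : D x -> ((N ^+ 2)%:E * (\1_A x)%:E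
    + (2 * N)%:E * \sum_(i < q) (Y i x)%:E
    <= \sum_(i < q) \sum_(j < q) (Y i x * Y j x)%:E + (N ^+ 2)%:E)%E.
  move=> Dx; rewrite sumEFin -EFinM -EFinM -EFinD.
  under [X in (_ <= X + _)%E]eq_bigr => i _ do rewrite sumEFin.
  rewrite sumEFin -EFinD lee_fin.
  under [X in _ <= X + _]eq_bigr => i _ do rewrite -mulr_sumr.
  rewrite -mulr_suml indicE; case: (boolP (x \in A)) => [|_] /=.
    rewrite inE => Ax; rewrite big1 ?mulr0 ?mul0r ?addr0 ?add0r ?mulr1//.
    by move=> i _; exact: YA.
  rewrite mulr0 add0r -subr_ge0 (_ : _ - _ = (\sum_(i < q) Y i x - N) ^+ 2).
    exact: sqr_ge0.
  ring.
have mYY i j : measurable_fun D (fun x => (Y i x * Y j x)%:E : \bar R).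
  by apply/measurable_EFinP; exact: measurable_funM.
have mYE i : measurable_fun D (EFin \o Y i).
  by apply/measurable_EFinP.
have YY0 i j x : D x -> (0 <= (Y i x * Y j x)%:E)%E.
  by move=> Dx; rewrite lee_fin mulr_ge0// Y0.
have YE0 i x : D x -> (0 <= (Y i x)%:E)%E by move=> Dx; rewrite lee_fin Y0.
have mind : measurable_fun D (EFin \o (\1_A : T -> R)).
  by apply/measurable_EFinP; exact: measurable_indic.
have PAfin : P A \is a fin_num.
  rewrite ge0_fin_numE//; apply: le_lt_trans (ltry 1); rewrite -PD.
  by apply: le_measure; rewrite ?inE.
have sY0 x : D x -> (0 <= \sum_(i < q) (Y i x)%:E)%E.
  by move=> Dx; apply: sume_ge0 => i _; exact: YE0.
have sYY0 x : D x -> (0 <= \sum_(i < q) \sum_(j < q) (Y i x * Y j x)%:E)%E.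
  by move=> Dx; apply: sume_ge0 => i _; apply: sume_ge0 => j _; exact: YY0.
have msY : measurable_fun D (fun x => (\sum_(i < q) (Y i x)%:E)%E).
  exact: emeasurable_sum.
have msYY i : measurable_fun D (fun x => (\sum_(j < q) (Y i x * Y j x)%:E)%E).
  exact: emeasurable_sum.
have mssYY : measurable_fun D
    (fun x => (\sum_(i < q) \sum_(j < q) (Y i x * Y j x)%:E)%E).
  by apply: emeasurable_sum => i; exact: msYY.
have := @ge0_le_integral _ _ _ P D mD _ _ _ _ _ key.
rewrite ge0_integralD//=; last 4 first.
- by move=> x Dx; rewrite mule_ge0// lee_fin ?sqr_ge0.
- exact: emeasurable_funM.
- by move=> x Dx; rewrite mule_ge0 ?lee_fin ?mulr_ge0// sY0.
- exact: emeasurable_funM.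
rewrite ge0_integralD//=; last first.
- by move=> x Dx; rewrite lee_fin sqr_ge0.
rewrite ge0_integralZl_EFin ?sqr_ge0//.
rewrite ge0_integralZl_EFin ?mulr_ge0//.
rewrite integral_indic// setIidl// ge0_integral_sum//.
under eq_bigr => i _ do rewrite EY.
rewrite ge0_integral_sum//; last first.
- by move=> i x Dx; apply: sume_ge0 => j _; exact: YY0.
rewrite integral_cst// PD mule1.
have bnd : (\sum_(i < q) \int[P]_(x in D) \sum_(j < q) (Y i x * Y j x)%:E <=
    (N ^+ 2 + (q%:R * m + q%:R ^+ 2 * c))%:E)%E.
  apply: (@le_trans _ _ (\sum_(i < q) (m + q%:R * (m ^+ 2 + c))%:E)%E).
    apply: lee_sum => i _; rewrite ge0_integral_sum//; last first.
      by move=> j x Dx; exact: YY0.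
    rewrite (bigD1 i)//= EFinD; apply: leeD.
      rewrite -(EY i); apply: ge0_le_integral => //.
      + by move=> x Dx; exact: YY0.
      + exact: mYE.
      + by move=> x Dx; rewrite lee_fin ler_piMl ?Y0//; have /andP[] := Y01 i x Dx.
    apply: (@le_trans _ _ (\sum_(j < q | j != i) (m ^+ 2 + c)%:E)%E).
      by apply: lee_sum => j ji; apply: EYY; rewrite eq_sym.
    (* The q - 1 indices distinct from i are counted as q, so that the total is exactly N^2 + N +
       q^2 c. *)
    rewrite sumEFin lee_fin sumr_const -[X in X <= _]mulr_natl ler_wpM2r ?addr_ge0 ?sqr_ge0//.
    by rewrite ler_nat -[leqRHS]card_ord max_card.
  rewrite sumEFin lee_fin sumr_const card_ord /N -mulr_natl le_eqVlt.
  by apply/orP; left; apply/eqP; ring.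
move=> h.
have {h} : ((N ^+ 2)%:E * P A + (2 * N)%:E * \sum_(i < q) m%:E <=
  (N ^+ 2 + (q%:R * m + q%:R ^+ 2 * c))%:E + (N ^+ 2)%:E)%E.
  apply: le_trans (leeD2r _ bnd); apply: h.
  - move=> x Dx; rewrite adde_ge0// mule_ge0 ?lee_fin ?mulr_ge0 ?sqr_ge0//.
    exact: sY0.
  - by apply: emeasurable_funD; exact: emeasurable_funM.
  - exact: emeasurable_funD.
rewrite -(fineK PAfin) sumEFin sumr_const card_ord -[m *+ q]mulr_natl -/N.
rewrite -!EFinM -!EFinD lee_fin; nra.
Qed.

Lemma iter_sub {T : Type} (X : set T) (f : T -> T) :
  f @` X `<=` X -> forall i x, X x -> X (iter i f x).
Proof.
by move=> fX; elim=> [//|i ih] x Xx; apply: fX; exists (iter i f x) => //; exact: ih.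
Qed.

Lemma measurable_fun_iter {disp} {T : measurableType disp} (X : set T)
    (f : T -> T) :
  measurable X -> f @` X `<=` X -> measurable_fun X f ->
  forall i, measurable_fun X (iter i f).
Proof.
move=> mX fX mf; elim=> [|i ih]; first exact: measurable_id.
apply: (measurable_comp mX _ mf ih).
by move=> _ [x Xx <-]; exact: iter_sub.
Qed.

Lemma probability1_setI {disp} {T : measurableType disp} {R : realType}
    (P : probability T R) (X A : set T) :
  measurable X -> measurable A -> P X = 1%E -> P (X `&` A) = P A.
Proof.
move=> mX mA PX; have mXA := measurableI _ _ mX mA.
have PCX : P (~` X) = 0%E by rewrite probability_setC// PX subee.
have -> : P A = (P (A `\` X) + P (A `&` X))%E by exact: measureDI.
rewrite setIC.
suff -> : P (A `\` X) = 0%E by rewrite add0e.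
apply/eqP; rewrite eq_le measure_ge0 andbT -PCX.
apply: le_measure; rewrite ?inE; [exact: measurableD|exact: measurableC|].
by move=> x [].
Qed.

Lemma f_invariant_iter {R : realType} {d : nat} (nu : probability (Rd R d) R)
    (Xs : set (Rd R d)) (f : Rd R d -> Rd R d) :
  measurable Xs -> f @` Xs `<=` Xs -> measurable_fun Xs f ->
  nu Xs = 1%E -> f_invariant nu Xs f -> forall i, f_invariant nu Xs (iter i f).
Proof.
move=> mX fX mf nuX inv; elim=> [|i ih] A mA.
  exact: probability1_setI.
have mi := measurable_fun_iter _ _ mX fX mf i.
rewrite -(ih A mA) -[RHS](inv _ (mi mX A mA)).
congr (nu _); apply/seteqP; split=> x [Xx Ax]; split=> //=.
- by split; [apply: fX; exists x|rewrite /= -iterSr].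
- by case: Ax => _; rewrite /= -iterSr.
Qed.

(** Change of variables: the image of [nu] under [iter i f] agrees with [nu] on measurable subsets
    of [Xs]. This shifts a correlation between two times so that the earlier one becomes 0. *)
Lemma integral_iter {R : realType} {d : nat} (nu : probability (Rd R d) R)
    (Xs : set (Rd R d)) (f : Rd R d -> Rd R d) (h : Rd R d -> \bar R) (i : nat) :
  measurable Xs -> f @` Xs `<=` Xs -> measurable_fun Xs f ->
  nu Xs = 1%E -> f_invariant nu Xs f ->
  measurable_fun Xs h -> (forall x, Xs x -> (0 <= h x)%E) ->
  (\int[nu]_(x in Xs) h (iter i f x) = \int[nu]_(x in Xs) h x)%E.
Proof.
move=> mX fX mf nuX inv mh h0.
have mi := measurable_fun_iter _ _ mX fX mf i.
(* [iter i f] need not be measurable off [Xs] *)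
pose G x := if x \in Xs then iter i f x else x.
have GX : G @^-1` Xs = Xs.
  apply/seteqP; split=> x /=; rewrite /G; case: ifPn => //.
  - by rewrite inE.
  - by rewrite inE => Xx _; exact: iter_sub.
have mG : measurable_fun setT G.
  apply: (measurable_fun_if measurableT) => //.
  - apply: (measurable_fun_bool true); rewrite setTI.
    by rewrite (_ : _ @^-1` _ = Xs)//; apply/seteqP; split=> x /= => [/set_mem|/mem_set].
  - rewrite setTI (_ : _ @^-1` _ = Xs)//.
    by apply/seteqP; split=> x /= => [/set_mem|/mem_set].
have GE x : Xs x -> G x = iter i f x by move=> Xx; rewrite /G mem_set.
have -> : (\int[nu]_(x in Xs) h (iter i f x) =
    \int[nu]_(x in G @^-1` Xs) (h \o G) x)%E.
  by rewrite GX; apply: eq_integral => x /[1!inE] Xx /=; rewrite GE.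
rewrite -(@ge0_integral_pushforward _ _ _ _ _ G mG nu Xs h)//.
  apply: eq_measure_integral => A mA AX; rewrite /pushforward.
  transitivity (nu (Xs `&` iter i f @^-1` A)); last exact: f_invariant_iter.
  congr (nu _); apply/seteqP; split=> x /=.
  - move=> AGx; have Xx : Xs x by rewrite -GX; exact: AX.
    by split=> //; rewrite /= -GE.
  - by move=> [Xx Ax]; rewrite /= GE.
by move=> x /[1!inE]; exact: h0.
Qed.

(** * The probability of missing a ball *)

(** The empty set is covered since its [sup] is 0 by convention; the set of Lipschitz quotients can
    be empty. *)
Lemma sup_itv_bound {R : realType} (E : set R) (b : R) :
  0 <= b -> (forall t, E t -> 0 <= t <= b) -> 0 <= sup E <= b.
Proof.
move=> b0 Eb; have [->|/set0P[t Et]] := eqVneq E set0; first by rewrite sup0 lexx.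
have ubE : ubound E b by move=> u /Eb/andP[].
rewrite ge_sup ?andbT//; last by exists t.
have /andP[t0 _] := Eb t Et.
by apply: le_trans t0 _; apply: ub_le_sup => //; exists b.
Qed.

(** A Lipschitz substitute for the indicator of a ball, to which (A1) applies: it lies between half
    the indicator of B(xt, r/2) and the indicator of B(xt, r). *)
Definition bump {R : realType} {d : nat} (xt : Rd R d) (r : R) (x : Rd R d) : R :=
  Num.max 0 (1 - edist x xt / r).

Section bump_theory.
Context {R : realType} {d : nat} (xt : Rd R d) (r : R) (r0 : 0 < r).

Lemma bump_ge0 x : 0 <= bump xt r x.
Proof. by rewrite /bump le_max lexx. Qed.

Lemma bump_le1 x : bump xt r x <= 1.
Proof.
rewrite /bump ge_max ler01/=.
have : 0 <= edist x xt / r by rewrite divr_ge0 ?edist_ge0 ?ltW.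
lra.
Qed.

Lemma bump_eq0 x : r <= edist x xt -> bump xt r x = 0.
Proof. by move=> h; apply/max_idPl; rewrite subr_le0 ler_pdivlMr// mul1r. Qed.

Lemma bump_ge_half x : edist x xt < r / 2 -> 2^-1 <= bump xt r x.
Proof.
move=> /ltW h; rewrite /bump le_max; apply/orP; right.
have : edist x xt / r <= 2^-1 by rewrite ler_pdivrMr// mulrC.
lra.
Qed.

Lemma bump_lipschitz x y :
  `|bump xt r x - bump xt r y| <= r^-1 * edist x y.
Proof.
have tri u v : edist u xt / r <= edist v xt / r + r^-1 * edist u v.
  rewrite mulrC [X in X + _]mulrC -mulrDr ler_pM2l ?invr_gt0// addrC.
  exact: edist_triangle.
have h1 := tri x y; have h2 := tri y x; rewrite (edistC _ _ y x) in h2.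
have e0 : 0 <= r^-1 * edist x y by rewrite mulr_ge0 ?invr_ge0 ?edist_ge0 ?ltW.
rewrite ler_norml /bump.
by case: (leP 0 (1 - edist x xt / r)); case: (leP 0 (1 - edist y xt / r)) => a b;
  lra.
Qed.

Lemma measurable_bump : measurable_fun setT (bump xt r).
Proof.
apply: measurable_maxr => //; apply: measurable_funB => //.
by apply: measurable_funM => //; exact: measurable_edist.
Qed.

Lemma is_lip_bump (Xs : set (Rd R d)) : is_lip Xs (bump xt r).
Proof.
exists 1, r^-1; split=> [x _|x y _ _]; last exact: bump_lipschitz.
by rewrite ger0_norm ?bump_ge0// bump_le1.
Qed.

(** The sup norm is at most 1 and the Lipschitz constant at most 1/r; [r <= 1] merges them into
    2/r. *)
Lemma lip_norm_bump (Xs : set (Rd R d)) :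
  r <= 1 -> 0 <= lip_norm Xs (bump xt r) <= 2 / r.
Proof.
move=> r1; rewrite /lip_norm.
set A := [set _ | _ in _]; set B := [set t | _].
have ri : 1 <= r^-1 by rewrite invf_ge1.
have /andP[A0 A1] : 0 <= sup A <= 1.
  apply: sup_itv_bound => // _ [x _ <-].
  by rewrite normr_ge0/= ger0_norm ?bump_ge0// bump_le1.
have /andP[B0 B1] : 0 <= sup B <= r^-1.
  apply: sup_itv_bound; first by rewrite invr_ge0 ltW.
  move=> _ [x [y [_ _ xy ->]]]; rewrite divr_ge0 ?edist_ge0//=.
  by rewrite ler_pdivrMr ?bump_lipschitz// lt_def xy edist_ge0.
by rewrite addr_ge0//=; lra.
Qed.

End bump_theory.

(** For r > 0 and inside [Xs], this is the event M_n > - ln r. *)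
Definition hit_set {R : realType} {d : nat} (Xs : set (Rd R d))
    (f : Rd R d -> Rd R d) (xt : Rd R d) (r : R) (n : nat) : set (Rd R d) :=
  \bigcup_(i in `I_n) (Xs `&` iter i f @^-1` eball xt r).

Lemma measurable_hit_set {R : realType} {d : nat} (Xs : set (Rd R d))
    (f : Rd R d -> Rd R d) (xt : Rd R d) (r : R) (n : nat) :
  measurable Xs -> f @` Xs `<=` Xs -> measurable_fun Xs f ->
  measurable (hit_set Xs f xt r n).
Proof.
move=> mX fX mf; apply: bigcup_measurable => i _.
apply: (measurable_fun_iter _ _ mX fX mf i) => //; exact: measurable_eball.
Qed.

Lemma cond_A1_ge0 {R : realType} {d : nat} (nu : probability (Rd R d) R)
    (Xs : set (Rd R d)) (f : Rd R d -> Rd R d) (Theta : nat -> R) :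
  cond_A1 nu Xs f Theta -> forall j, 0 <= Theta j.
Proof.
move=> [Tdec T0 _] j; have Tcvg : cvgn Theta by apply/cvg_ex; exists 0.
rewrite -(cvg_lim _ T0)//.
by apply: nonincreasing_cvgn_ge => // m n mn; exact: Tdec.
Qed.

(** The second moment bound is applied to the bump along the times 0, p, .., (q-1)p. Its mean m is
    at least b/2, and (A1) supplies the covariance bound c. Division by (q m)^2 leaves 1/(q m) +
    c/m^2. *)
Lemma no_hit_bound {R : realType} {d : nat} (nu : probability (Rd R d) R)
    (Xs : set (Rd R d)) (f : Rd R d -> Rd R d) (xt : Rd R d)
    (Theta : nat -> R) (r : R) (p q : nat) (b := fine (nu (eball xt (r / 2)))) :
  measurable Xs -> f @` Xs `<=` Xs -> measurable_fun Xs f ->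
  nu Xs = 1%E -> f_invariant nu Xs f -> cond_A1 nu Xs f Theta ->
  0 < r <= 1 -> 0 < b -> (0 < p)%N -> (0 < q)%N ->
  fine (nu (Xs `\` hit_set Xs f xt r (q * p)))
    <= 2 / (q%:R * b) + 16 * Theta p / (r ^+ 2 * b ^+ 2).
Proof.
move=> mX fX mf nuX inv A1 /andP[r0 r1] b0 p0 q0.
have Tge0 := cond_A1_ge0 _ _ _ _ A1; have [Tdec _ corr] := A1.
set g := bump xt r.
have mg : measurable_fun Xs g.
  by apply: measurable_funTS; exact: measurable_bump.
have mgi i : measurable_fun Xs (fun x => g (iter i f x)).
  apply: (measurable_comp measurableT) => //; first exact: measurable_bump.
  exact: measurable_fun_iter.
have g01 x : 0 <= g x <= 1 by rewrite bump_ge0 bump_le1.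
have g0 x : 0 <= g x by exact: bump_ge0.
have nufin A : (nu A <= 1)%E -> nu A \is a fin_num.
  by move=> h; rewrite ge0_fin_numE//; apply: le_lt_trans h (ltry _).
have Eg1 : (\int[nu]_(x in Xs) (g x)%:E <= 1)%E.
  rewrite -nuX -[leRHS]mul1e -(integral_cst nu mX 1%E).
  apply: ge0_le_integral => //.
  - by move=> x _; rewrite lee_fin.
  - exact/measurable_EFinP.
  - by move=> x _; rewrite lee_fin; have /andP[] := g01 x.
have Eg0 : (0 <= \int[nu]_(x in Xs) (g x)%:E)%E.
  by apply: integral_ge0 => x _; rewrite lee_fin.
have Egfin : (\int[nu]_(x in Xs) (g x)%:E)%E \is a fin_num.
  by rewrite ge0_fin_numE//; apply: le_lt_trans Eg1 (ltry _).
set m := fine (\int[nu]_(x in Xs) (g x)%:E)%E.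
have Eg : (\int[nu]_(x in Xs) (g x)%:E)%E = m%:E by rewrite fineK.
have mE := measurable_eball R d xt (r / 2).
have bm : b / 2 <= m.
  rewrite -lee_fin -Eg mulrC EFinM /b fineK; last first.
    by apply: nufin; exact: probability_le1.
  have -> : (nu (eball xt (r / 2)) =
      \int[nu]_(x in Xs) (\1_(eball xt (r / 2)) x)%:E)%E.
    by rewrite integral_indic// setIC; apply/esym/probability1_setI.
  rewrite -ge0_integralZl_EFin//; last first.
    by apply/measurable_EFinP; exact: measurable_indic.
  apply: ge0_le_integral => //.
  - apply: emeasurable_funM => //; apply/measurable_EFinP; exact: measurable_indic.
  - exact/measurable_EFinP.
  move=> x _; rewrite -EFinM lee_fin indicE; case: (boolP (_ \in _)) => h /=.
    rewrite mulr1; apply: bump_ge_half => //.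
    by move: h; rewrite inE /eball /= edistC.
  by rewrite mulr0.
have m0 : 0 < m by apply: lt_le_trans bm; rewrite divr_gt0.
(* The right-hand side of (A1) at gap p, with both Lipschitz norms bounded by 2/r; larger gaps obey
   the same bound as [Theta] is nonincreasing. *)
pose c := Theta p * (2 / r) ^+ 2.
have c0 : 0 <= c by rewrite mulr_ge0 ?sqr_ge0.
have Egg k : (p <= k)%N ->
    (\int[nu]_(x in Xs) (g x * g (iter k f x))%:E <= (m ^+ 2 + c)%:E)%E.
  move=> pk; have lipg : is_lip Xs g by exact: is_lip_bump.
  have := corr g g k lipg lipg; rewrite Eg -EFinM => /(le_trans (lee_abs _)).
  rewrite leeBlDr// => /le_trans; apply.
  rewrite -EFinD lee_fin addrC expr2 lerD2l /c -mulrA.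
  have /andP[L0 L1] := lip_norm_bump xt r r0 Xs r1.
  apply: ler_pM => //; first exact: mulr_ge0.
    exact: Tdec.
  by rewrite expr2; exact: ler_pM.
pose Y (i : 'I_q) x := g (iter (i * p) f x).
have YY (i j : 'I_q) : (i < j)%N ->
    (\int[nu]_(x in Xs) (Y i x * Y j x)%:E <= (m ^+ 2 + c)%:E)%E.
  (* Invariance removes the common time i p, leaving a gap k >= p. *)
  move=> ij; set k := ((j - i) * p)%N.
  have jE : (j * p = k + i * p)%N by rewrite /k -mulnDl subnK// ltnW.
  rewrite /Y jE; under eq_integral => x _ do rewrite iterD.
  rewrite (integral_iter nu Xs f (fun y => (g y * g (iter k f y))%:E))//.
  - by apply: Egg; rewrite /k leq_pmull// subn_gt0.
  - by apply/measurable_EFinP; exact: measurable_funM.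
  - by move=> x _; rewrite lee_fin mulr_ge0.
have mA : measurable (Xs `\` hit_set Xs f xt r (q * p)).
  by apply: measurableD => //; exact: measurable_hit_set.
have := second_moment_bound nu Xs q Y m c _ mX nuX (ltW m0) c0 _ _ _ _ mA.
set PA := fine _ => /(_ (fun i => mgi _) (fun i x _ => g01 _)) H.
have {H} H : (q%:R * m) ^+ 2 * PA <= q%:R * m + q%:R ^+ 2 * c.
  apply: H.
  - move=> i; rewrite -Eg.
    apply: (integral_iter nu Xs f (fun y => (g y)%:E)) => //.
    + exact/measurable_EFinP.
    + by move=> x _; rewrite lee_fin.
  - move=> i j; rewrite neq_ltn => /orP[ij|ji]; first exact: YY.
    by under eq_integral => x _ do rewrite mulrC; exact: YY.
  - by move=> x [].
  (* Each sampling time i p is below q p, so an orbit that misses the ball makes every sampled bump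
     vanish. *)
  - move=> i x [Xx nhit]; apply: bump_eq0 => //; rewrite leNgt; apply/negP => h.
    apply: nhit; exists (i * p)%N => /=; first by rewrite ltn_pmul2r.
    by split=> //; rewrite /= /eball /= edistC.
have q0' : 0 < q%:R :> R by rewrite ltr0n.
have {H} : PA <= (q%:R * m)^-1 + c / m ^+ 2.
  rewrite -(ler_pM2l (exprn_gt0 2 (mulr_gt0 q0' m0))).
  apply: le_trans H _; rewrite le_eqVlt; apply/orP; left; apply/eqP.
  by field; rewrite !gt_eqF.
move=> /le_trans; apply; apply: lerD.
  rewrite -[2]invrK -invfM lef_pV2 ?posrE ?mulr_gt0 ?invr_gt0//.
  by rewrite mulrCA ler_pM2l// mulrC.
(* The factor 16 is 2^2 from the Lipschitz norms times 2^2 from m >= b/2. *)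
have -> : 16 * Theta p / (r ^+ 2 * b ^+ 2) = c / (b / 2) ^+ 2.
  by rewrite /c; field; rewrite !gt_eqF.
apply: ler_wpM2l => //.
have b20 : 0 < b / 2 by rewrite divr_gt0.
rewrite lef_pV2 ?posrE ?exprn_gt0//.
by apply: lerXn2r => //; rewrite nnegrE ltW.
Qed.

(** * Borel-Cantelli and the local dimension *)

(** First Borel-Cantelli lemma. The bound is known only from rank [K] on, so it is applied to the
    sequence shifted by [K], where x^(k+K) <= x^k. *)
Lemma ae_eventually_not_geometric {disp} {T : measurableType disp}
    {R : realType} (P : {measure set T -> \bar R}) (A : nat -> set T) (C x : R)
    (K : nat) :
  (forall k, measurable (A k)) -> 0 <= C -> 0 < x < 1 ->
  (forall k, (K <= k)%N -> (P (A k) <= (C * x ^+ k)%:E)%E) ->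
  {ae P, forall t, exists K', forall k, (K' <= k)%N -> ~ A k t}.
Proof.
move=> mA C0 /andP[x0 x1] PA; pose F k := A (k + K)%N.
have sumF : (\sum_(k <oo) P (F k) < +oo)%E.
  apply: (@le_lt_trans _ _ (C * (1 - x)^-1)%:E); last exact: ltry.
  apply: lime_le; first exact: is_cvg_nneseries.
  apply: nearW => n; apply: (@le_trans _ _ (\sum_(0 <= k < n) (C * x ^+ k)%:E)%E).
    apply: lee_sum => k _; apply: le_trans (PA _ (leq_addl _ _)) _.
    rewrite lee_fin ler_wpM2l// exprD; apply: ler_piMr; first exact/exprn_ge0/ltW.
    by rewrite exprn_ile1// ltW.
  rewrite sumEFin lee_fin.
  by apply: (@geometric_le_lim R n C x) => //; rewrite gtr0_norm.
exists (lim_sup_set F); split.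
- apply: bigcap_measurable => // n _; apply: bigcup_measurable => k _.
  exact: mA.
- by apply: lim_sup_set_cvg0 => // k; exact: mA.
- move=> t /= h n _; apply: contrapT => h'; apply: h.
  exists (n + K)%N => k nk Akt; apply: h'.
  have Kk : (K <= k)%N by apply: leq_trans nk; exact: leq_addl.
  by exists (k - K)%N; rewrite /F /= ?subnK// leq_subRL// addnC.
Qed.

Lemma le_limn_einf {R : realType} (u : nat -> \bar R) (l : \bar R) (N : nat) :
  (forall n, (N <= n)%N -> (l <= u n)%E) -> (l <= limn_einf u)%E.
Proof.
move=> h; rewrite limn_einf_lim; apply: lime_ge; first exact: is_cvg_einfs.
near=> n; apply: le_ereal_inf_tmp => _ [m /= nm <-]; apply: h.
by apply: leq_trans nm; near: n; exists N.
Unshelve. all: by end_near. Qed.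

Lemma limn_esup_le {R : realType} (u : nat -> \bar R) (l : \bar R) (N : nat) :
  (forall n, (N <= n)%N -> (u n <= l)%E) -> (limn_esup u <= l)%E.
Proof.
move=> h; rewrite limn_esup_lim; apply: lime_le; first exact: is_cvg_esups.
near=> n; apply: ge_ereal_sup => _ [m /= nm <-]; apply: h.
by apply: leq_trans nm; near: n; exists N.
Unshelve. all: by end_near. Qed.

(** Squeeze between the infimum and the supremum of the tails; [l] may be infinite, as it is in
    dimension 0. *)
Lemma cvg_of_limn_einf_esup {R : realType} (u : nat -> \bar R) (l : \bar R) :
  (l <= limn_einf u)%E -> (limn_esup u <= l)%E -> u @ \oo --> l.
Proof.
move=> li ls.
have e1 : limn_einf u = l.
  by apply/eqP; rewrite eq_le li (le_trans (limn_einf_sup u) ls).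
have e2 : limn_esup u = l.
  by apply/eqP; rewrite eq_le ls (le_trans li (limn_einf_sup u)).
apply: (@squeeze_cvge _ _ _ _ (einfs u) _ (esups u)).
- apply: nearW => n; apply/andP; split.
    by apply: ereal_inf_lbound; exists n => /=.
  by apply: ereal_sup_ubound; exists n => /=.
- by rewrite -e1 limn_einf_lim; exact: is_cvg_einfs.
- by rewrite -e2 limn_esup_lim; exact: is_cvg_esups.
Qed.

Lemma exists_expr_lt {R : realType} (x e : R) :
  0 < x < 1 -> 0 < e -> exists K : nat, forall k, (K <= k)%N -> x ^+ k < e.
Proof.
move=> /andP[x0 x1] e0.
have /cvgrPdist_lt /(_ _ e0) [K _ hK] : (fun k => x ^+ k) @ \oo --> (0 : R).
  by apply: cvg_expr; rewrite gtr0_norm.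
exists K => k Kk; have := hK k Kk; rewrite /= sub0r normrN gtr0_norm//.
exact: exprn_gt0.
Qed.

Lemma powR_exprn {R : realType} (x a : R) (k : nat) :
  0 <= x -> (x ^+ k) `^ a = (x `^ a) ^+ k.
Proof. by move=> x0; rewrite -!powR_mulrn ?powR_ge0// powRAC. Qed.

(** The quotient of logarithms is within [eta] of [dnu] for small r. Multiplying by ln r reverses
    the inequalities, and exponentiating gives the powers; capping the radius at 1 makes ln r
    negative. *)
Lemma local_dim_bounds {R : realType} {d : nat} (nu : probability (Rd R d) R)
    (xt : Rd R d) (dnu eta : R) :
  local_dim nu xt dnu -> 0 < eta ->
  exists2 r1 : R, 0 < r1 & forall r, 0 < r < r1 ->
    r `^ (dnu + eta) <= fine (nu (eball xt r)) <= r `^ (dnu - eta).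
Proof.
move=> [pos /cvgrPdist_lt lim] eta0; have := lim _ eta0.
move=> [e /= e0 he]; exists (Num.min e 1); first by rewrite lt_min e0 ltr01.
move=> r /andP[r0]; rewrite lt_min => /andP[re r1].
have := he r; rewrite /ball_ /= sub0r normrN gtr0_norm// => /(_ re r0).
have nuf : nu (eball xt r) \is a fin_num.
  rewrite ge0_fin_numE//; apply: le_lt_trans (ltry 1).
  by apply: probability_le1; exact: measurable_eball.
have b0 : 0 < fine (nu (eball xt r)) by rewrite fine_gt0// pos//= -ge0_fin_numE.
have lr : ln r < 0 by rewrite ln_lt0// r0.
rewrite ltr_norml => /andP[h1 h2].
rewrite -{1 2}(lnK b0) /powR gt_eqF// !ler_expR.
have h3 : ln (fine (nu (eball xt r))) / ln r * ln r = ln (fine (nu (eball xt r))).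
  by rewrite mulfVK// lt_eqF.
set L := ln (fine _) in h1 h2 h3 *; set q := L / ln r in h1 h2 h3.
by rewrite -h3 !ler_nM2r//; apply/andP; split; lra.
Qed.

(** Otherwise a ball of small radius r < 1 would have measure at least r^(dnu/2) > 1. *)
Lemma local_dim_ge0 {R : realType} {d : nat} (nu : probability (Rd R d) R)
    (xt : Rd R d) (dnu : R) : local_dim nu xt dnu -> 0 <= dnu.
Proof.
move=> ld; rewrite leNgt; apply/negP => d0.
have e0 : 0 < - dnu / 2 by rewrite divr_gt0// oppr_gt0.
have [r1 r10 h] := local_dim_bounds nu xt dnu _ ld e0.
pose r := Num.min r1 1 / 2.
have m0 : 0 < Num.min r1 1 by rewrite lt_min r10 ltr01.
have r0 : 0 < r by rewrite divr_gt0.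
have [mr1 m1] : Num.min r1 1 <= r1 /\ Num.min r1 1 <= 1 by rewrite !ge_min !lexx orbT.
have rr1 : r < r1 by rewrite /r; lra.
have r1' : r < 1 by rewrite /r; lra.
have /andP[+ _] := h r (introT andP (conj r0 rr1)).
have b1 : fine (nu (eball xt r)) <= 1.
  have le1 := probability_le1 nu (measurable_eball _ _ xt r).
  rewrite -lee_fin fineK// ge0_fin_numE//.
  exact: le_lt_trans le1 (ltry 1).
move=> /le_trans /(_ b1); apply/negP; rewrite -ltNge.
have dlt : dnu + - dnu / 2 < 0 by lra.
by rewrite /powR gt_eqF// expR_gt1 nmulr_rgt0// ln_lt0// r0.
Qed.

(** * Growth of the maxima along almost every orbit *)

(** For c^k <= n < c^(k+1), the hit gives M_n >= k a while ln n <= (k+1) L, so the ratio is at least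
    a/L - (a/L)/(k+1): the geometric scale costs nothing in the limit. *)
Lemma liminf_Mratio_ge {R : realType} {d : nat} (f : Rd R d -> Rd R d)
    (xt x : Rd R d) (rho : R) (c K : nat) :
  (1 < c)%N -> 0 < rho < 1 ->
  (forall k, (K <= k)%N -> exists2 i, (i < c ^ k)%N &
    edist (iter i f x) xt < rho ^+ k) ->
  ((- ln rho / ln c%:R)%:E <= limn_einf (Mratio f xt x))%E.
Proof.
move=> c1 /andP[rho0 rho1] hit; set a := - ln rho; set L := ln c%:R.
have a0 : 0 < a by rewrite oppr_gt0 ln_lt0// rho0.
have L0 : 0 < L by rewrite ln_gt0// ltr1n.
apply/lee_subgt0Pr => e e0.
(* The last entry makes the loss (a/L)/(k+1) smaller than e. *)
pose K1 := maxn (maxn K 1) (Num.truncn (a / L / e)).+1.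
apply: (@le_limn_einf _ _ _ (c ^ K1)) => n Kn.
have n0 : (0 < n)%N by apply: leq_trans Kn; rewrite expn_gt0 ltnW.
have /andP[kn nk] := trunc_log_bounds c1 n0.
set k := trunc_log c n in kn nk.
have K1k : (K1 <= k)%N by rewrite /k; apply: trunc_log_max.
have Kk : (K <= k)%N by apply: leq_trans K1k; rewrite !leq_max leqnn.
have k1 : (0 < k)%N by apply: leq_trans K1k; rewrite !leq_max leqnn orbT.
have Ke : a / L / e < k%:R.
  apply: lt_le_trans (truncnS_gt _) _; rewrite ler_nat.
  by apply: leq_trans K1k; rewrite leq_max leqnn orbT.
have [i ik hi] := hit k Kk.
have Mge : ((k%:R * a)%:E <= Mn f xt n x)%E.
  apply: (@le_trans _ _ (phi xt (iter i f x))); last first.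
    rewrite /Mn; have i_n : (i < n)%N by apply: leq_trans ik kn.
    exact: (le_bigmax _ (fun j : 'I_n => phi xt (iter j f x)) (Ordinal i_n)).
  rewrite /phi; case: ifPn => [_|h]; first exact: leey.
  have e0' : 0 < edist (iter i f x) xt by rewrite lt_def h edist_ge0.
  rewrite lee_fin /a mulrN lerN2 mulr_natl -lnXn//.
  by rewrite ler_ln ?posrE ?exprn_gt0// ltW.
have cR : 0 < c%:R :> R by rewrite ltr0n ltnW.
have lnn : ln n%:R <= k.+1%:R * L.
  rewrite /L mulr_natl -lnXn// ler_ln ?posrE ?exprn_gt0// ?ltr0n//.
  by rewrite -natrX ler_nat ltnW.
have lnn0 : 0 < ln n%:R :> R.
  rewrite ln_gt0// ltr1n; apply: leq_trans kn.
  by rewrite -(exp1n k) ltn_exp2r.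
rewrite /Mratio -EFinB.
apply: (@le_trans _ _ ((k%:R * a)%:E * ((ln n%:R)^-1)%:E)%E); last first.
  by apply: lee_wpmul2r => //; rewrite lee_fin invr_ge0 ltW.
rewrite -EFinM lee_fin.
apply: (@le_trans _ _ (k%:R * a / (k.+1%:R * L))); last first.
  rewrite ler_pM2l ?mulr_gt0 ?ltr0n// lef_pV2 ?posrE// mulr_gt0 ?ltr0n//.
have -> : k%:R * a / (k.+1%:R * L) = a / L - a / L / k.+1%:R.
  have kp : 0 < k%:R + 1 :> R by rewrite ltr_wpDl.
  by rewrite -natr1; field; rewrite !gt_eqF.
rewrite lerD2l lerN2 ler_pdivrMr ?ltr0n// [leRHS]mulrC -ler_pdivrMr//.
by apply: ltW; apply: lt_le_trans Ke _; rewrite ler_nat.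
Qed.

(** Hits are excluded up to c^(k+1), which exceeds every n of the k-th block. Then M_n <= k a and ln
    n >= k L, so the bound a/L has no error term. *)
Lemma limsup_Mratio_le {R : realType} {d : nat} (f : Rd R d -> Rd R d)
    (xt x : Rd R d) (rho : R) (c K : nat) :
  (1 < c)%N -> 0 < rho < 1 ->
  (forall k, (K <= k)%N -> forall i, (i < c ^ k.+1)%N ->
    rho ^+ k <= edist (iter i f x) xt) ->
  (limn_esup (Mratio f xt x) <= (- ln rho / ln c%:R)%:E)%E.
Proof.
move=> c1 /andP[rho0 rho1] nohit; set a := - ln rho; set L := ln c%:R.
have a0 : 0 < a by rewrite oppr_gt0 ln_lt0// rho0.
have L0 : 0 < L by rewrite ln_gt0// ltr1n.
apply: (@limn_esup_le _ _ _ (c ^ maxn K 1)) => n Kn.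
have n0 : (0 < n)%N by apply: leq_trans Kn; rewrite expn_gt0 ltnW.
have /andP[kn nk] := trunc_log_bounds c1 n0.
set k := trunc_log c n in kn nk.
have K1k : (maxn K 1 <= k)%N by rewrite /k; apply: trunc_log_max.
have Kk : (K <= k)%N by apply: leq_trans K1k; rewrite leq_max leqnn.
have k1 : (0 < k)%N by apply: leq_trans K1k; rewrite leq_max leqnn orbT.
have Mle : (Mn f xt n x <= (k%:R * a)%:E)%E.
  apply/bigmax_leP; split=> [|i _]; first exact: leNye.
  have h := nohit k Kk i (ltn_trans (ltn_ord i) nk).
  have h0 : 0 < edist (iter i f x) xt by apply: lt_le_trans h; rewrite exprn_gt0.
  rewrite /phi gt_eqF// lee_fin /a mulrN lerN2 mulr_natl -lnXn//.
  by rewrite ler_ln ?posrE ?exprn_gt0.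
have cR : 0 < c%:R :> R by rewrite ltr0n ltnW.
have lnn : k%:R * L <= ln n%:R.
  rewrite /L mulr_natl -lnXn// ler_ln ?posrE ?exprn_gt0// ?ltr0n//.
  by rewrite -natrX ler_nat.
have kL0 : 0 < k%:R * L by rewrite mulr_gt0 ?ltr0n.
rewrite /Mratio.
apply: (@le_trans _ _ ((k%:R * a)%:E * ((ln n%:R)^-1)%:E)%E).
  by apply: lee_wpmul2r => //; rewrite lee_fin invr_ge0 (le_trans _ lnn)// ltW.
rewrite -EFinM lee_fin ler_pdivrMr; last exact: lt_le_trans lnn.
have -> : k%:R * a = a / L * (k%:R * L) by field; rewrite gt_eqF.
by rewrite ler_pM2l ?divr_gt0.
Qed.

(** Union bound; by invariance each of the n events has the measure of the ball. *)
Lemma hit_set_le {R : realType} {d : nat} (nu : probability (Rd R d) R)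
    (Xs : set (Rd R d)) (f : Rd R d -> Rd R d) (xt : Rd R d) (r : R) (n : nat) :
  measurable Xs -> f @` Xs `<=` Xs -> measurable_fun Xs f ->
  nu Xs = 1%E -> f_invariant nu Xs f ->
  (nu (hit_set Xs f xt r n) <= (n%:R * fine (nu (eball xt r)))%:E)%E.
Proof.
move=> mX fX mf nuX inv; have mE := measurable_eball R d xt r.
have mS i : measurable (Xs `&` iter i f @^-1` eball xt r).
  exact: (measurable_fun_iter _ _ mX fX mf i).
apply: (@le_trans _ _ (\sum_(i < n) nu (Xs `&` iter i f @^-1` eball xt r))%E).
  apply: (@content_subadditive _ _ _ nu
    _ (fun i => Xs `&` iter i f @^-1` eball xt r)) => //.
    exact: measurable_hit_set.
  by rewrite /hit_set bigcup_mkord.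
under eq_bigr => i _ do rewrite (f_invariant_iter nu Xs f mX fX mf nuX inv i _ mE).
have nuf : nu (eball xt r) \is a fin_num.
  rewrite ge0_fin_numE//; apply: le_lt_trans (ltry 1); exact: probability_le1.
by rewrite -(fineK nuf) sumEFin sumr_const card_ord mulr_natl fineK.
Qed.

Lemma ae_full_measure {disp} {T : measurableType disp} {R : realType}
    (P : probability T R) (X : set T) :
  measurable X -> P X = 1%E -> {ae P, forall x, X x}.
Proof.
move=> mX PX; exists (~` X); split; first exact: measurableC.
  by rewrite probability_setC// PX subee.
by move=> x.
Qed.

Lemma powR2_lt1 {R : realType} (t : R) : t < 0 -> 0 < 2 `^ t < 1.
Proof.
move=> t0; rewrite powR_gt0//= /powR gt_eqF// expR_lt1 nmulr_rlt0//.
by rewrite ln_gt0// ltr1n.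
Qed.

Lemma ae_limsup_Mratio_le_of_gt {R : realType} {d : nat}
    (nu : probability (Rd R d) R) (Xs : set (Rd R d)) (f : Rd R d -> Rd R d)
    (xt : Rd R d) (dnu u : R) :
  measurable Xs -> f @` Xs `<=` Xs -> measurable_fun Xs f ->
  nu Xs = 1%E -> f_invariant nu Xs f -> local_dim nu xt dnu ->
  0 < u -> 1 < u * dnu ->
  {ae nu, forall x, (limn_esup (Mratio f xt x) <= u%:E)%E}.
Proof.
move=> mX fX mf nuX inv ld u0 ud.
(* Half the gap, so that u (dnu - eta) = (u dnu + 1)/2 is still above 1. *)
pose eta := (dnu - u^-1) / 2.
have eta0 : 0 < eta by rewrite divr_gt0// subr_gt0 -[u^-1]mulr1 ltr_pdivrMl.
have [r1 r10 hr1] := local_dim_bounds nu xt dnu eta ld eta0.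
pose rho : R := 2 `^ (- u).
have rho01 : 0 < rho < 1 by apply: powR2_lt1; rewrite oppr_lt0.
have /andP[rho0 rho1] := rho01.
(* With radius 2^(-uk), the union bound 2^(k+1) (2^(-uk))^(dnu - eta) equals 2 x^k. *)
pose x : R := 2 `^ (1 - u * (dnu - eta)).
have x01 : 0 < x < 1.
  apply: powR2_lt1; have : u * eta = (u * dnu - 1) / 2.
    by rewrite /eta; field; rewrite gt_eqF.
  by rewrite mulrBr; lra.
have [K hK] := exists_expr_lt rho r1 rho01 r10.
have BC : {ae nu, forall t, exists K', forall k, (K' <= k)%N ->
    ~ hit_set Xs f xt (rho ^+ k) (2 ^ k.+1) t}.
  apply: (ae_eventually_not_geometric nu
    (fun k => hit_set Xs f xt (rho ^+ k) (2 ^ k.+1)) 2 x K) => //.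
    by move=> k; exact: measurable_hit_set.
  move=> k Kk; apply: le_trans (hit_set_le nu Xs f xt _ _ mX fX mf nuX inv) _.
  have rk : 0 < rho ^+ k < r1 by rewrite exprn_gt0//= hK.
  have /andP[_ hB] := hr1 _ rk.
  rewrite lee_fin natrX exprS -mulrA ler_pM2l//.
  apply: (@le_trans _ _ (2 ^+ k * (rho ^+ k) `^ (dnu - eta))).
    by rewrite ler_pM2l ?exprn_gt0.
  rewrite powR_exprn; last exact: ltW.
  rewrite -exprMn /x /rho -powRrM.
  by rewrite powRD ?pnatr_eq0 ?implybT// powRr1// mulNr.
apply: filterS2 (ae_full_measure nu Xs mX nuX) BC => t Xt [K' hK'].
have -> : u = - ln rho / ln 2%:R.
  by rewrite /rho ln_powR !mulNr opprK mulfK// gt_eqF// ln_gt0// ltr1n.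
apply: (limsup_Mratio_le f xt t rho 2 K') => // k Kk i ik.
rewrite leNgt; apply/negP => h; apply: (hK' k Kk).
by exists i => //; split=> //; rewrite /= /eball /= edistC.
Qed.

(** Countably many exponents u decreasing to 1/dnu suffice, so the exceptional sets have a null
    union. *)
Lemma ae_limsup_Mratio_le {R : realType} {d : nat}
    (nu : probability (Rd R d) R) (Xs : set (Rd R d)) (f : Rd R d -> Rd R d)
    (xt : Rd R d) (dnu : R) :
  measurable Xs -> f @` Xs `<=` Xs -> measurable_fun Xs f ->
  nu Xs = 1%E -> f_invariant nu Xs f -> local_dim nu xt dnu -> 0 < dnu ->
  {ae nu, forall x, (limn_esup (Mratio f xt x) <= (dnu^-1)%:E)%E}.
Proof.
move=> mX fX mf nuX inv ld d0.
have H (j : nat) : {ae nu, forall x,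
    (limn_esup (Mratio f xt x) <= (dnu^-1 + j.+1%:R^-1)%:E)%E}.
  apply: (ae_limsup_Mratio_le_of_gt nu Xs f xt dnu) => //.
    by rewrite addr_gt0// invr_gt0.
  by rewrite mulrDl mulVf ?gt_eqF// ltrDl mulr_gt0// invr_gt0.
have HH := ae_foralln H.
apply: filterS HH => x hx.
apply/lee_addgt0Pr => e e0; apply: le_trans (hx (Num.truncn e^-1)) _.
rewrite -EFinD lee_fin lerD2l -[leRHS]invrK lef_pV2 ?posrE ?invr_gt0//.
by apply: ltW; exact: truncnS_gt.
Qed.

(** Take p = 2^k, q = 2^(bk) and radius 2^(-ak) with a = s (b+1). The two strict inequalities make
    the two terms of [no_hit_bound] geometric. A hit within 2^(-ak) before time 2^((b+1)k) then
    yields the ratio a/(b+1) = s. *)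
Lemma ae_liminf_Mratio_ge {R : realType} {d : nat}
    (nu : probability (Rd R d) R) (Xs : set (Rd R d)) (f : Rd R d -> Rd R d)
    (xt : Rd R d) (dnu : R) (Theta : nat -> R) (b N : nat) (s eta zeta C : R) :
  measurable Xs -> f @` Xs `<=` Xs -> measurable_fun Xs f ->
  nu Xs = 1%E -> f_invariant nu Xs f -> local_dim nu xt dnu ->
  cond_A1 nu Xs f Theta ->
  (forall n, (N <= n)%N -> Theta n <= C * n%:R `^ (- zeta)) ->
  0 < s -> 0 < eta ->
  s * b.+1%:R * (dnu + eta) < b%:R ->
  s * b.+1%:R * (2 + 2 * (dnu + eta)) < zeta ->
  {ae nu, forall x, (s%:E <= limn_einf (Mratio f xt x))%E}.
Proof.
move=> mX fX mf nuX inv ld A1 hTheta s0 eta0.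
set a := s * b.+1%:R; set D := dnu + eta => ab az.
have a0 : 0 < a by rewrite mulr_gt0.
have [r1 r10 hr1] := local_dim_bounds nu xt dnu eta ld eta0.
pose rho : R := 2 `^ (- a).
have rho01 : 0 < rho < 1 by apply: powR2_lt1; rewrite oppr_lt0.
have /andP[rho0 rho1] := rho01.
pose y := rho `^ D; pose Q : R := 2 ^+ b; pose z : R := 2 `^ (- zeta).
(* The price of the halved radius in [no_hit_bound]: (rho^k / 2)^D = w y^k. *)
pose w : R := 2^-1 `^ D.
have y0 : 0 < y by exact: powR_gt0.
have w0 : 0 < w by exact: powR_gt0.
have Q0 : 0 < Q by exact: exprn_gt0.
have z0 : 0 < z by exact: powR_gt0.
pose x1 := (Q * y)^-1; pose x2 := z / (rho ^+ 2 * y ^+ 2).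
have E2 (t1 t2 : R) : 2 `^ (t1 + t2) = 2 `^ t1 * 2 `^ t2 :> R.
  by rewrite powRD// pnatr_eq0 implybT.
have yE : y = 2 `^ (- (a * D)) by rewrite /y /rho -powRrM mulNr.
have x101 : 0 < x1 < 1.
  suff -> : x1 = 2 `^ (a * D - b%:R) by apply: powR2_lt1; rewrite subr_lt0.
  apply: (mulfI (_ : Q * y != 0)); first by rewrite gt_eqF// mulr_gt0.
  rewrite divff ?gt_eqF ?mulr_gt0// yE /Q -powR_mulrn// -!E2.
  by rewrite (_ : _ + _ = 0) ?powRr0//; ring.
have x201 : 0 < x2 < 1.
  suff -> : x2 = 2 `^ (a * (2 + 2 * D) - zeta).
    by apply: powR2_lt1; rewrite subr_lt0.
  have n0 : rho ^+ 2 * y ^+ 2 != 0 by rewrite gt_eqF// mulr_gt0 ?exprn_gt0.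
  apply: (mulIf n0); rewrite divfK// yE /rho !expr2 -!E2 /z.
  by congr (_ `^ _); ring.
pose x := Num.max x1 x2.
have x01 : 0 < x < 1.
  by rewrite lt_max gt_max; case/andP: x101 => -> ->; case/andP: x201 => _ ->.
(* The constants of the two terms; [C] may be negative, hence the absolute value. *)
pose C1 := 2 / w + 16 * `|C| / w ^+ 2.
have C10 : 0 <= C1.
  by rewrite addr_ge0// mulr_ge0// ?invr_ge0 ?exprn_ge0 ?ltW// mulr_gt0.
have [K0 hK0] := exists_expr_lt rho r1 rho01 r10.
pose A k := Xs `\` hit_set Xs f xt (rho ^+ k) ((2 ^ b) ^ k * 2 ^ k).
have BC : {ae nu, forall t, exists K', forall k, (K' <= k)%N -> ~ A k t}.
  apply: (ae_eventually_not_geometric nu A C1 x (maxn N K0)) => //.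
    by move=> k; apply: measurableD => //; exact: measurable_hit_set.
  move=> k; rewrite geq_max => /andP[Nk Kk].
  have rk0 : 0 < rho ^+ k by exact: exprn_gt0.
  have rk1 : rho ^+ k <= 1 by rewrite exprn_ile1// ltW.
  have rk : 0 < rho ^+ k / 2 < r1.
    by rewrite divr_gt0//=; have := hK0 k Kk; lra.
  have /andP[+ _] := hr1 _ rk; rewrite (powRM _ (ltW rk0))// -/D -/w.
  rewrite powR_exprn; last exact: ltW.
  rewrite -/y mulrC => hB.
  set B := fine _ in hB.
  have B0 : 0 < B by apply: lt_le_trans hB; rewrite mulr_gt0// exprn_gt0.
  have yk0 : 0 < y ^+ k by exact: exprn_gt0.
  have Qk0 : 0 < Q ^+ k by exact: exprn_gt0.
  have p0 : (0 < 2 ^ k)%N by rewrite expn_gt0.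
  have q0 : (0 < (2 ^ b) ^ k)%N by rewrite !expn_gt0.
  have := no_hit_bound nu Xs f xt Theta (rho ^+ k) (2 ^ k) ((2 ^ b) ^ k)
    mX fX mf nuX inv A1 (introT andP (conj rk0 rk1)) B0 p0 q0.
  rewrite -/B -/(A k) => H.
  have Afin : nu (A k) \is a fin_num.
    rewrite ge0_fin_numE//; apply: le_lt_trans (ltry 1); apply: probability_le1.
    by apply: measurableD => //; exact: measurable_hit_set.
  apply: (@le_trans _ _ (fine (nu (A k)))%:E); first by rewrite fineK.
  rewrite lee_fin; apply: le_trans H _.
  (* The decay bound applies at gap 2^k since 2^k > k >= N. *)
  have Tk : Theta (2 ^ k)%N <= `|C| * z ^+ k.
    apply: le_trans (hTheta _ _) _.
      by apply: leq_trans Nk _; apply: ltnW; exact: ltn_expl.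
    rewrite natrX powR_exprn// -/z ler_pM2r ?exprn_gt0//; exact: ler_norm.
  rewrite /C1 [leRHS]mulrDl; apply: lerD.
    apply: (@le_trans _ _ (2 / w * x1 ^+ k)).
      rewrite /x1 exprVn exprMn -mulrA -invfM ler_pM2l//.
      rewrite lef_pV2 ?posrE ?mulr_gt0//.
      by rewrite mulrCA !natrX -/Q ler_pM2l.
    rewrite ler_pM2l ?divr_gt0//; apply: lerXn2r; rewrite ?nnegrE.
    - by case/andP: x101 => /ltW.
    - by case/andP: x01 => /ltW.
    - by rewrite le_max lexx.
  apply: (@le_trans _ _ (16 * `|C| / w ^+ 2 * x2 ^+ k)); last first.
    apply: ler_wpM2l.
      by rewrite mulr_ge0// ?invr_ge0 ?exprn_ge0 ?ltW// mulr_gt0.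
    apply: lerXn2r; rewrite ?nnegrE.
    - by case/andP: x201 => /ltW.
    - by case/andP: x01 => /ltW.
    - by rewrite le_max lexx orbT.
  have -> : 16 * `|C| / w ^+ 2 * x2 ^+ k =
      (16 * (`|C| * z ^+ k)) / ((rho ^+ k) ^+ 2 * (w * y ^+ k) ^+ 2).
    rewrite /x2 exprMn exprVn exprMn -!exprM (mulnC 2 k) !exprM.
    by field; rewrite !gt_eqF.
  apply: ler_pM.
  - by rewrite mulr_ge0// (cond_A1_ge0 _ _ _ _ A1).
  - by rewrite invr_ge0 mulr_ge0// sqr_ge0.
  - by rewrite ler_pM2l.
  - rewrite lef_pV2 ?posrE ?mulr_gt0 ?exprn_gt0// ?mulr_gt0//.
    rewrite ler_pM2l ?exprn_gt0//; apply: lerXn2r => //.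
    - by rewrite nnegrE ltW// mulr_gt0.
    - by rewrite nnegrE ltW.
apply: filterS2 (ae_full_measure nu Xs mX nuX) BC => t Xt [K' hK'].
have -> : s = - ln rho / ln (2 ^ b.+1)%:R.
  rewrite /rho ln_powR !mulNr opprK natrX lnXn// /a -mulr_natl.
  have ln2 : 0 < ln 2 :> R by rewrite ln_gt0// ltr1n.
  by field; rewrite nat1r pnatr_eq0/= gt_eqF.
apply: (liminf_Mratio_ge f xt t rho (2 ^ b.+1) K') => //.
  by rewrite -(expn0 2) ltn_exp2l.
move=> k Kk; have := hK' k Kk; rewrite /A => nA.
have [i /= ik [_ hi]] : hit_set Xs f xt (rho ^+ k) ((2 ^ b) ^ k * 2 ^ k) t.
  by apply: contrapT => nh; apply: nA; split.
exists i; first by rewrite expnS expnMn mulnC.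
by rewrite edistC.
Qed.

(** * Local dimension zero *)

(** Ergodicity is applied to the set of points visiting [xt] infinitely often: it is exactly
    invariant, whereas a single visit may be lost by applying [f]. Every tail union contains some
    [F n], of measure nu{xt}, so the limsup set has positive measure, hence measure 1. *)
Lemma ae_hits_atom {R : realType} {d : nat} (nu : probability (Rd R d) R)
    (Xs : set (Rd R d)) (f : Rd R d -> Rd R d) (xt : Rd R d) :
  measurable Xs -> f @` Xs `<=` Xs -> measurable_fun Xs f ->
  nu Xs = 1%E -> f_invariant nu Xs f -> f_ergodic nu Xs f ->
  (0 < nu [set xt])%E ->
  {ae nu, forall x, exists i, iter i f x = xt}.
Proof.
move=> mX fX mf nuX inv erg atom; have mxt := measurable_point _ _ xt.
pose F i := Xs `&` iter i f @^-1` [set xt].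
have mF i : measurable (F i) by exact: (measurable_fun_iter _ _ mX fX mf i).
have mtail n : measurable (\bigcup_(j in [set j | (n <= j)%N]) F j).
  by apply: bigcup_measurable => j _.
have mA : measurable (lim_sup_set F) by apply: bigcap_measurable.
have AE x : Xs x -> lim_sup_set F x <->
    (forall n, exists2 i, (n <= i)%N & iter i f x = xt).
  move=> Xx; split=> h n; first by have [i ni [_ <-]] := h n I; exists i.
  by move=> _; have [i ni ix] := h n; exists i.
have Ainv : Xs `&` f @^-1` lim_sup_set F = Xs `&` lim_sup_set F.
  apply/seteqP; split=> x [Xx Ax]; split=> //.
  - have Xfx : Xs (f x) by apply: fX; exists x.
    apply/AE => // n; have [i ni <-] := (AE _ Xfx).1 Ax n.
    by exists i.+1; [exact: ltnW|rewrite iterSr].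
  - have Xfx : Xs (f x) by apply: fX; exists x.
    (* Asking for a visit at time at least n+1 rules out time 0 and leaves one at time at least n
       for [f x]. *)
    apply/(AE _ Xfx) => n; have [[//|i] ni <-] := (AE _ Xx).1 Ax n.+1.
    by exists i => //; rewrite iterSr.
have Apos : (nu [set xt] <= nu (lim_sup_set F))%E.
  have c := @lim_sup_set_cvg _ _ _ nu F mF.
  have tailfin : (nu (\bigcup_(k >= 0) F k) < +oo)%E.
    by apply: le_lt_trans (ltry 1); exact: probability_le1.
  have {}c := c tailfin.
  rewrite -(cvg_lim _ c)//; apply: lime_ge; first by apply/cvg_ex; eexists; exact: c.
  apply: nearW => n.
  rewrite -[leLHS](f_invariant_iter nu Xs f mX fX mf nuX inv n _ mxt).
  apply: le_measure; rewrite ?inE//; first exact: mF.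
  by move=> y Fy; exists n => /=.
have A1 : nu (lim_sup_set F) = 1%E.
  by case: (erg _ mA Ainv) => // A0; move: Apos; rewrite A0 leNgt atom.
apply: filterS (ae_full_measure nu _ mA A1) => x Ax.
by have [i _ [_ ix]] := Ax 0%N I; exists i.
Qed.

Lemma Mratio_hit {R : realType} {d : nat} (f : Rd R d -> Rd R d)
    (xt x : Rd R d) :
  (exists i, iter i f x = xt) -> (+oo <= limn_einf (Mratio f xt x))%E.
Proof.
(* From n = 2 on, 1 / ln n is positive and the infinite maximum stays infinite. *)
move=> [i ix]; apply: (@le_limn_einf _ _ _ (maxn i.+1 2)) => n.
rewrite geq_max => /andP[i_n n2].
rewrite /Mratio (_ : Mn f xt n x = +oo%E) ?gt0_mulye//.
  by rewrite lte_fin invr_gt0 ln_gt0// ltr1n.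
apply/eqP; rewrite eq_le leey/=.
have <- : phi xt (iter i f x) = +oo%E by rewrite ix /phi edist_refl eqxx.
exact: (le_bigmax _ (fun j : 'I_n => phi xt (iter j f x)) (Ordinal i_n)).
Qed.

(** Without an atom, summing (A2) over the annuli between the radii [r k] bounds nu(B(xt, r k)) by a
    multiple of (r k)^delta. Dimension 0 gives the lower bound (r k)^(delta/2), a contradiction for
    large k. *)
Lemma local_dim0_atom {R : realType} {d : nat} (nu : probability (Rd R d) R)
    (xt : Rd R d) :
  local_dim nu xt 0 -> cond_A2 nu xt -> (0 < nu [set xt])%E.
Proof.
move=> ld [delta [r0 [C [delta0 r00 C0 hA2]]]].
rewrite lt0e measure_ge0 andbT; apply/eqP => atom0.
have e0 : 0 < delta / 2 by rewrite divr_gt0.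
have [r1 r10 hr1] := local_dim_bounds nu xt 0 _ ld e0.
pose R0 := Num.min r0 r1 / 2.
have m0 : 0 < Num.min r0 r1 by rewrite lt_min r00.
have [mr0 mr1] : Num.min r0 r1 <= r0 /\ Num.min r0 r1 <= r1.
  by rewrite !ge_min !lexx orbT.
have R00 : 0 < R0 by rewrite divr_gt0.
have R0r0 : R0 < r0 by rewrite /R0; lra.
have R0r1 : R0 < r1 by rewrite /R0; lra.
(* The ratio exceeds 1/2, so the annulus width r_(k+1)/2 is strictly below the inner radius, as (A2)
   requires. *)
pose th : R := 2 / 3.
have th0 : 0 < th by rewrite divr_gt0.
have th1 : th <= 1 by rewrite /th; lra.
pose r k := R0 * th ^+ k.
have rpos k : 0 < r k by rewrite mulr_gt0// exprn_gt0.
have rR0 k : r k <= R0.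
  by rewrite -[leRHS]mulr1 ler_pM2l// exprn_ile1// ltW.
have mE k : measurable (eball xt (r k)) by exact: measurable_eball.
have nufin k : nu (eball xt (r k)) \is a fin_num.
  by rewrite ge0_fin_numE//; apply: le_lt_trans (ltry 1); exact: probability_le1.
pose a k := fine (nu (eball xt (r k))).
(* The lower bound decays like q'^k and the upper one like q'^(2k). *)
pose q' := th `^ (delta / 2); pose q := q' ^+ 2.
have q'01 : 0 < q' < 1.
  rewrite powR_gt0//= /q' /powR gt_eqF// expR_lt1 pmulr_rlt0//.
  by rewrite ln_lt0// th0 /th/=; lra.
have /andP[q'0 q'1] := q'01.
have q0 : 0 < q by rewrite exprn_gt0.
have q1 : q < 1 by rewrite exprn_ilt1// ltW.
have qE : q = th `^ delta.
  by rewrite /q /q' -powR_mulrn ?powR_ge0// -powRrM divfK.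
pose E := C * (R0 / 3) `^ delta.
have E0 : 0 < E by rewrite mulr_gt0// powR_gt0// divr_gt0.
have step k : a k <= a k.+1 + E * q ^+ k.
  have rS : r k = r k.+1 + r k.+1 / 2 by rewrite /r exprS /th; field.
  have eE : r k.+1 / 2 = R0 / 3 * th ^+ k by rewrite /r exprS /th; field.
  have := hA2 (r k.+1 / 2) (r k.+1); rewrite -rS -/(a k) -/(a k.+1).
  have h1 : 0 < r k.+1 / 2 by rewrite divr_gt0.
  have h2 : r k.+1 / 2 < r k.+1 by have := rpos k.+1; lra.
  move=> /(_ h1 h2 (le_lt_trans (rR0 _) R0r0)).
  rewrite eE powRM; [|by rewrite ltW// divr_gt0|by rewrite ltW// exprn_gt0].
  rewrite powR_exprn; last exact: ltW.
  rewrite -qE mulrA -/E => h; have := le_trans (ler_norm _) h; lra.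
(* g q^k is the tail of the series of annulus bounds. Subtracting it from [a k] gives a
   nondecreasing sequence, which lies below the limit nu{xt} = 0 of [a]. *)
pose g := E / (1 - q).
have gE : E = g - g * q by rewrite /g; field; rewrite gt_eqF// subr_gt0.
have g0 : 0 < g by rewrite divr_gt0// subr_gt0.
pose b k := a k - g * q ^+ k.
have bS : nondecreasing_seq b.
  apply/nondecreasing_seqP => k; rewrite /b exprS; have := step k.
  by rewrite {1}gE; lra.
have bcap : \bigcap_k eball xt (r k) = [set xt].
  apply/seteqP; split=> [y h|y -> k _]; last by rewrite /eball /= edist_refl.
  apply/esym/edist0_eq/eqP; rewrite eq_le edist_ge0 andbT leNgt; apply/negP => xy.
  have th01 : 0 < th < 1 by rewrite th0 /th; lra.
  have [K hK] := exists_expr_lt th (edist xt y / R0) th01 (divr_gt0 xy R00).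
  have := h K I; rewrite /eball /= /r => hy.
  have := hK K (leqnn K); rewrite ltr_pdivlMr// mulrC => /(lt_trans hy).
  by rewrite ltxx.
have cvga : nu (eball xt (r k)) @[k --> \oo] --> nu [set xt].
  rewrite -bcap; apply: (@nonincreasing_cvg_mu _ _ _ nu) => //.
  - by apply: le_lt_trans (ltry 1); exact: probability_le1.
  - by rewrite bcap; exact: measurable_point.
  - move=> m n mn; apply/subsetPset => y; rewrite /eball /= => /lt_le_trans; apply.
    by rewrite /r ler_pM2l// ler_wiXn2l// ltW.
have ale k : a k <= g * q ^+ k.
  have : ((b k)%:E <= 0)%E.
    rewrite -atom0 -(cvg_lim _ cvga)//.
    apply: lime_ge; first by apply/cvg_ex; eexists; exact: cvga.
    exists k => // n /= kn; rewrite -(fineK (nufin n)) lee_fin.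
    apply: le_trans (bS _ _ kn) _; rewrite /b -/(a n) lerBlDr lerDl.
    by rewrite mulr_ge0 ?exprn_ge0 ?ltW.
  by rewrite lee_fin subr_le0.
have w0 : 0 < R0 `^ (delta / 2) by exact: powR_gt0.
have [K hK] := exists_expr_lt q' (R0 `^ (delta / 2) / g) q'01 (divr_gt0 w0 g0).
have rK : 0 < r K < r1 by rewrite rpos (le_lt_trans (rR0 K)).
have /andP[+ _] := hr1 _ rK; rewrite -/(a K) add0r => h.
have := le_trans h (ale K); rewrite /r powRM; [|exact: ltW|by rewrite ltW// exprn_gt0].
rewrite powR_exprn; last exact: ltW.
rewrite -/q' /q -exprM mulnC exprM expr2 mulrA ler_pM2r ?exprn_gt0//.
have := hK K (leqnn K); rewrite ltr_pdivlMr// mulrC => /le_lt_trans H /H.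
by rewrite ltxx.
Qed.

(** * Exponential rates, and the proof of both parts of the theorem *)

(** With l = - ln theta0 and t = l n / zeta this is zeta ln t <= zeta t = l n. It puts exponential
    decay under [ae_liminf_Mratio_ge] for every [zeta]. *)
Lemma exponential_le_powR {R : realType} (theta0 zeta : R) (n : nat) :
  0 < theta0 < 1 -> 0 < zeta -> (0 < n)%N ->
  theta0 ^+ n <= (- ln theta0 / zeta) `^ (- zeta) * n%:R `^ (- zeta).
Proof.
move=> /andP[t0 t1] z0 n0; set l := - ln theta0.
have l0 : 0 < l by rewrite oppr_gt0 ln_lt0// t0.
have nR : 0 < n%:R :> R by rewrite ltr0n.
have lz : 0 < l / zeta by rewrite divr_gt0.
have lzn : 0 < l / zeta * n%:R by rewrite mulr_gt0.
rewrite -powRM ?(ltW lz)// /powR gt_eqF// -[leLHS]lnK ?posrE ?exprn_gt0//.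
rewrite ler_expR lnXn// mulNr -[ln theta0]opprK -/l mulNrn lerN2 -[l *+ n]mulr_natr.
have h : ln (l / zeta * n%:R) <= l / zeta * n%:R.
  by apply: ltW; exact: ln_sublinear.
apply: (@le_trans _ _ (zeta * (l / zeta * n%:R))); first by rewrite ler_pM2l.
by rewrite le_eqVlt; apply/orP; left; apply/eqP; field; rewrite gt_eqF.
Qed.

Theorem theorem2p2 (R : realType) (d : nat) (Xs : set (Rd R d))
  (f : Rd R d -> Rd R d) (nu : probability (Rd R d) R) (xt : Rd R d) (dnu : R) :
  measurable Xs -> f @` Xs `<=` Xs -> measurable_fun Xs f ->
  nu Xs = 1%E -> f_invariant nu Xs f -> f_ergodic nu Xs f ->
  Xs xt -> local_dim nu xt dnu -> cond_A2 nu xt ->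
  ((exists Theta : nat -> R, cond_A1 nu Xs f Theta /\
      exists theta0 C : R, exists N : nat, 0 < theta0 < 1 /\
        forall n, (N <= n)%N -> Theta n <= C * theta0 ^+ n) ->
   {ae nu, forall x, Mratio f xt x @ \oo --> inv_dim dnu})
  /\
  ((exists Theta : nat -> R, cond_A1 nu Xs f Theta /\
      exists zeta C : R, exists N : nat, 0 < zeta /\
        forall n, (N <= n)%N -> Theta n <= C * n%:R `^ (- zeta)) ->
   exists beta : R, 0 < beta < 1 /\
     {ae nu, forall x,
        (beta%:E * inv_dim dnu <= limn_einf (Mratio f xt x))%E /\
        (limn_esup (Mratio f xt x) <= inv_dim dnu)%E}).
Proof.
move=> mX fX mf nuX inv erg Xxt ld A2.
have [d0|dn0] := eqVneq dnu 0.
  rewrite {dnu}d0 in ld *; rewrite /inv_dim eqxx.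
  have hits := ae_hits_atom nu Xs f xt mX fX mf nuX inv erg
    (local_dim0_atom nu xt ld A2).
  split=> _.
    apply: filterS hits => x /Mratio_hit h.
    by apply: cvg_of_limn_einf_esup => //; exact: leey.
  (* Any beta in (0,1) would do, both bounds being infinite. *)
  exists 2^-1; split; first by rewrite invr_gt0 ltr0n invf_lt1// ltr1n.
  apply: filterS hits => x /Mratio_hit h; split; last exact: leey.
  by apply: le_trans h; exact: leey.
have d0 : 0 < dnu by rewrite lt_def dn0 (local_dim_ge0 nu xt).
rewrite /inv_dim (negbTE dn0).
have upper := ae_limsup_Mratio_le nu Xs f xt dnu mX fX mf nuX inv ld d0.
split.
- move=> [Th [A1 [theta0 [C [N [t01 hT]]]]]].
  have H (s : R) : 0 < s -> s * dnu < 1 ->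
      {ae nu, forall x, (s%:E <= limn_einf (Mratio f xt x))%E}.
    move=> s0 sd.
    (* Half the gap again: s (dnu + eta) = (1 + s dnu)/2 = sg < 1. *)
    pose eta := (s^-1 - dnu) / 2.
    have eta0 : 0 < eta.
      by rewrite divr_gt0// subr_gt0 -[s^-1]mulr1 ltr_pdivlMl.
    pose sg := (1 + s * dnu) / 2.
    have sgE : s * (dnu + eta) = sg by rewrite /sg /eta; field; rewrite gt_eqF.
    have sg1 : 0 < 1 - sg by rewrite /sg; lra.
    (* b > sg / (1 - sg) is the requirement sg (b+1) < b. *)
    pose b := (Num.truncn (sg / (1 - sg))).+1.
    have hb : sg / (1 - sg) < b%:R by exact: truncnS_gt.
    (* Chosen after b, just above the threshold, since any power is available. *)
    pose zeta := s * b.+1%:R * (2 + 2 * (dnu + eta)) + 1.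
    have zeta0 : 0 < zeta.
      rewrite addr_gt0// mulr_gt0// ?mulr_gt0//.
      by rewrite addr_gt0// mulr_gt0// addr_gt0.
    apply: (ae_liminf_Mratio_ge nu Xs f xt dnu Th b (maxn N 1) s eta zeta
      (`|C| * (- ln theta0 / zeta) `^ (- zeta))) => //.
    + move=> n; rewrite geq_max => /andP[Nn n0]; apply: le_trans (hT n Nn) _.
      have /andP[t0 _] := t01.
      apply: (@le_trans _ _ (`|C| * theta0 ^+ n)).
        by rewrite ler_pM2r ?exprn_gt0// ler_norm.
      by rewrite -mulrA ler_wpM2l// exponential_le_powR.
    + rewrite mulrAC sgE -natr1.
      by move: hb; rewrite ltr_pdivrMr//; lra.
    + by rewrite /zeta ltrDl.
  have lower : {ae nu, forall x, (dnu^-1%:E <= limn_einf (Mratio f xt x))%E}.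
    (* Countably many s increasing to 1/dnu. *)
    have HH (j : nat) : {ae nu, forall x,
        ((dnu + j.+1%:R^-1)^-1%:E <= limn_einf (Mratio f xt x))%E}.
      have p0 : 0 < dnu + j.+1%:R^-1 by rewrite addr_gt0// invr_gt0.
      by apply: H; rewrite ?invr_gt0// mulrC ltr_pdivrMr// mul1r ltrDl invr_gt0.
    have HA := ae_foralln HH; apply: filterS HA => x hx.
    have c : ((dnu + n.+1%:R^-1)^-1)%:E @[n --> \oo] --> (dnu^-1)%:E.
      apply: cvg_EFin; first by apply: nearW => n.
      apply: cvgV => //; rewrite -[X in _ --> X]addr0.
      by apply: cvgD; [exact: cvg_cst|exact: cvg_harmonic].
    rewrite -(cvg_lim _ c)//; apply: lime_le; first by apply/cvg_ex; eexists; exact: c.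
    exact: nearW.
  by apply: filterS2 lower upper => x; exact: cvg_of_limn_einf_esup.
- move=> [Th [A1 [zeta [C [N [z0 hT]]]]]].
  (* With b = eta = 1 the requirements read 2s (dnu + 1) < 1 and 4s (dnu + 2) < zeta; the constant 8
     makes both strict. Then beta = s dnu, so that beta / dnu = s. *)
  pose s := Num.min 1 zeta / (8 * (dnu + 2)).
  have d2 : 0 < dnu + 2 by rewrite addr_gt0.
  have m0 : 0 < Num.min 1 zeta by rewrite lt_min ltr01.
  have [m1 mz] : Num.min 1 zeta <= 1 /\ Num.min 1 zeta <= zeta.
    by rewrite !ge_min !lexx orbT.
  have s0 : 0 < s by rewrite divr_gt0// mulr_gt0.
  have sE : 8 * (s * dnu) + 16 * s = Num.min 1 zeta.
    by rewrite /s; field; rewrite gt_eqF.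
  have sd0 : 0 < s * dnu by rewrite mulr_gt0.
  exists (s * dnu); split; first by rewrite sd0/=; lra.
  have lower : {ae nu, forall x, (s%:E <= limn_einf (Mratio f xt x))%E}.
    apply: (ae_liminf_Mratio_ge nu Xs f xt dnu Th 1 N s 1 zeta C) => //; lra.
  apply: filterS2 lower upper => x hl hu; split=> //.
  by rewrite -EFinM mulfK.
Qed.
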